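(* Let $f\in\mathcal{G}$. Then, for each $n\ge2$ and all $z$ with $|z|<1$, $$\left|\frac{s_n(z;f)}{f(z)}-1\right|\le |z|^n\left(\frac{1}{n(n+1)}+\frac{2|z|}{\sqrt{3}\,(1-|z|)}\right).$$
   Context: Let $\mathbb{D}=\{z\in\mathbb{C}:|z|<1\}$ and let $\mathcal{A}$ be the family of analytic functions $f$ in $\mathbb{D}$ with $f(0)=0$ and $f'(0)=1$, i.e. $f(z)=z+\sum_{k=2}^\infty a_kz^k$. $\mathcal{G}$ is the class of locally univalent $f\in\mathcal{A}$ (so $f'(z)\ne0$ in $\mathbb{D}$) satisfying $\Re\left(1+\frac{zf''(z)}{f'(z)}\right)<\frac32$ for all $z\in\mathbb{D}$; it is a known fact that functions in $\mathcal{G}$ are univalent in $\mathbb{D}$. The $n$-th section (partial sum) of $f$ is the polynomial $s_n(z;f)=z+\sum_{k=2}^n a_kz^k$. The quotient $s_n(z;f)/f(z)$ is given its limiting value $1$ at $z=0$. *)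

(* Defs.v *)
From Stdlib Require Import Reals Factorial.
From Coquelicot Require Import Coquelicot.

Local Open Scope R_scope.
Local Open Scope C_scope.

Definition in_disk (z : C) : Prop := Cmod z < 1.

(** Analyticity in the open unit disk: [f] is locally the sum of a convergent
    complex power series.  No condition is put on the values of [f] outside
    the disk. *)
Definition analytic_in_disk (f : C -> C) : Prop :=
  forall z0 : C, in_disk z0 ->
    exists (c : nat -> C) (r : R), 0 < r /\
      forall z : C, Cmod (z - z0) < r ->
        @is_pseries C_AbsRing C_NormedModule c (z - z0) (f z).

(** [C_derive] is a total operator, equal to the complex derivative wherever
    the latter exists ([is_C_derive_unique]); every derivative of an analytic
    function exists on the disk, so no junk value is ever used below. *)
Definition C_derive_n (f : C -> C) (k : nat) : C -> C := Nat.iter k C_derive f.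

Definition taylor_coef (f : C -> C) (k : nat) : C :=
  C_derive_n f k 0 / INR (fact k).

Definition class_A (f : C -> C) : Prop :=
  analytic_in_disk f /\ f 0 = 0 /\ C_derive f 0 = 1.

Definition locally_univalent (f : C -> C) : Prop :=
  forall z0 : C, in_disk z0 ->
    exists r : R, 0 < r /\
      forall z w : C, in_disk z -> in_disk w ->
        Cmod (z - z0) < r -> Cmod (w - z0) < r -> f z = f w -> z = w.

(** For analytic [f] the non-vanishing of the derivative is equivalent to local
    univalence; both are kept, so that the quotient below is a genuine one
    (division by [0] is total in [C]). *)
Definition class_G (f : C -> C) : Prop :=
  class_A f /\
  locally_univalent f /\
  (forall z : C, in_disk z -> C_derive f z <> 0) /\
  (forall z : C, in_disk z ->
     Re (1 + z * C_derive_n f 2 z / C_derive f z) < 3 / 2).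

(** [sum_n_m u 2 n] is the sum of [u k] for [2 <= k <= n]. *)
Definition partial_sum (f : C -> C) (n : nat) (z : C) : C :=
  z + sum_n_m (fun k => taylor_coef f k * z ^ k) 2 n.

(** The singularity at [0] is removable, with limiting value [1]. *)
Definition section_quotient (f : C -> C) (n : nat) (z : C) : C :=
  if Ceq_dec z 0 then 1 else partial_sum f n z / f z.

(* Main.v *)
Require Import Defs.
From Stdlib Require Import Reals Lra Lia Factorial Classical ClassicalEpsilon List.
From Coquelicot Require Import Coquelicot.
Local Open Scope R_scope.

(** Why the theorem holds.  Write [f(z) = z + a_2 z^2 + ...] and [r = |z|].  The
    defining condition of the class is [Re (z f''/f') < 1/2], and it implies
    [|a_k| <= 1/(k(k-1))] for [k >= 2] ([class_G_coef_bound]).  These numbers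
    decay fast enough for the triangle inequality to finish: the sum of
    [1/(k(k-1))] over [k > n + 1] is [1/(n+1)], hence

      [|f(z) - s_n(z)| <= r^(n+1) (1/(n(n+1)) + r/(n+1))],

    and for [n = 1] this gives [|f(z) - z| <= r^2], so [|f(z)| >= r (1 - r)].
    Dividing, [|s_n/f - 1| <= r^n (1/(n(n+1)) + r/(n(1-r)))], which is better than
    the claim since [1/n <= 1 <= 2/sqrt 3].

    The coefficient bound is a positivity argument on circles of radius
    [rho < 1].  If [q = z f''/f'] and [P] is a polynomial, then
    [Re ((q - 1/2) |P|^2) <= 0] on the circle, so its mean is nonpositive; a
    suitable [P] close to a Taylor polynomial of [f'] makes this mean explicit in
    the coefficients ([coef_bound_log_derivative]).

    No contour integral is used.  A mean over a circle is the value at [0] of a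
    holomorphic function whose real part agrees with the given function on the
    circle ([circle_mean]): on [|z| = rho] the conjugate of [z] is [rho^2 / z],
    which turns the products that occur into such real parts.  Positivity of
    means is then the maximum principle ([max_principle_Re]), proved from local
    Taylor expansions by comparing a value with the mean over the four vertices
    of a small square.  The same principle shows that the Taylor series at [0]
    represents [f] on the whole disk ([taylor_remainder_bound]).  The notion of
    holomorphy behind it ([holomorphic]) asks for expansions of every order at
    each point; it is stable under quotients by elementary algebra, and analytic
    functions and their derivatives have it by termwise differentiation of power
    series ([sums_to_derive]). *)

(** * Termwise differentiation of complex power series *)

Lemma C_pow_n (z : C) (k : nat) : @pow_n C_Ring z k = (z ^ k)%C.
Proof.
induction k as [|k IH]; [reflexivity|].
simpl pow_n. rewrite IH. reflexivity.
Qed.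

Lemma is_pseries_C (c : nat -> C) (z l : C) :
  @is_pseries C_AbsRing C_NormedModule c z l <->
  @is_series C_AbsRing C_NormedModule (fun k => c k * z ^ k)%C l.
Proof.
assert (H : forall n, scal (@pow_n C_Ring z n) (c n) = (c n * z ^ n)%C).
{ intros n. rewrite C_pow_n. apply Cmult_comm. }
unfold is_pseries; split; apply is_series_ext; intros n;
  [|symmetry]; apply H.
Qed.

Lemma Cmod_series_le (x : nat -> C) (y : nat -> R) (l : C) (s : R) :
  @is_series C_AbsRing C_NormedModule x l -> is_series y s ->
  (forall n, Cmod (x n) <= y n) -> Cmod l <= s.
Proof.
intros Hx Hy H.
assert (L : is_lim_seq (fun n => Cmod (@sum_n C_AbelianMonoid x n)) (Cmod l)).
{ exact (filterlim_comp _ _ _ _ _ _ _ _ Hx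
           (filterlim_norm (K := C_AbsRing) (V := C_NormedModule) l)). }
refine (is_lim_seq_le _ _ (Cmod l) s _ L Hy).
intros n. induction n as [|n IH].
- rewrite !sum_O. apply H.
- rewrite !sum_Sn. eapply Rle_trans; [apply Cmod_triangle|].
  apply Rplus_le_compat; [exact IH|apply H].
Qed.

(** Every derivative below is identified through this criterion, since both a
    power series and a germ with two known coefficients come with a quadratic
    error term. *)
Lemma C_derive_of_quadratic_error (f : C -> C) (z l : C) (K r : R) :
  0 < r ->
  (forall h, Cmod h < r -> Cmod (f (z + h) - f z - h * l)%C <= K * Cmod h ^ 2) ->
  C_derive f z = l.
Proof.
intros Hr H. apply is_C_derive_unique. split.
- apply is_linear_scal_l.
- intros x Hx.
  apply (is_filter_lim_locally_unique (K := C_AbsRing)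
           (V := AbsRing_NormedModule C_AbsRing)) in Hx.
  subst x. intros eps.
  assert (Hd : 0 < Rmin r (eps / (Rabs K + 1))).
  { apply Rmin_pos; [exact Hr|]. apply Rdiv_lt_0_compat; [apply cond_pos|].
    pose proof (Rabs_pos K); lra. }
  exists (mkposreal _ Hd). intros y Hy.
  change (Cmod (y - z)%C < Rmin r (eps / (Rabs K + 1))) in Hy.
  change (Cmod ((f y - f z) - (y - z) * l)%C <= eps * Cmod (y - z)%C).
  assert (Hy1 := Rlt_le_trans _ _ _ Hy (Rmin_l _ _)).
  assert (Hy2 := Rlt_le_trans _ _ _ Hy (Rmin_r _ _)).
  specialize (H _ Hy1).
  assert (E : forall a b : C, (a + (b - a))%C = b) by (intros; ring).
  rewrite E in H.
  eapply Rle_trans; [exact H|].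
  pose proof (Rabs_pos K) as HK. pose proof (Rle_abs K) as HK'.
  pose proof (Cmod_ge_0 (y - z)%C) as H0.
  assert (Cmod (y - z)%C * (Rabs K + 1) <= eps).
  { apply (Rmult_lt_compat_r (Rabs K + 1)) in Hy2; [|lra].
    unfold Rdiv in Hy2. rewrite Rmult_assoc, Rinv_l in Hy2; lra. }
  nra.
Qed.

Definition sums_to (c : nat -> C) (f : C -> C) (z0 : C) (r : R) : Prop :=
  forall z, Cmod (z - z0)%C < r ->
    @is_series C_AbsRing C_NormedModule (fun k => c k * (z - z0) ^ k)%C (f z).

Definition C_PS_derive (c : nat -> C) (k : nat) : C := (INR (S k) * c (S k))%C.

(** The error of the tangent line of a power, in a form that sums to the second
    derivative of a real power series.  The true constant is half as large. *)
Lemma power_difference_bound (w h : C) (s : R) (k : nat) :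
  Cmod w <= s -> Cmod (w + h)%C <= s ->
  Cmod ((w + h) ^ S (S k) - w ^ S (S k) - INR (S (S k)) * h * w ^ S k)%C
    <= INR (S k) * INR (S (S k)) * s ^ k * Cmod h ^ 2.
Proof.
intros Hw Hwh.
pose proof (Cmod_ge_0 w) as Hw0. pose proof (Cmod_ge_0 h) as Hh0.
induction k as [|k IH].
- replace ((w + h) ^ 2 - w ^ 2 - INR 2 * h * w ^ 1)%C with (h * h)%C.
  + rewrite Cmod_mult. simpl. nra.
  + change (INR 2) with 2. simpl Cpow. ring.
- set (n := S (S k)) in *.
  replace ((w + h) ^ S n - w ^ S n - INR (S n) * h * w ^ n)%C
    with ((w + h) * ((w + h) ^ n - w ^ n - INR n * h * w ^ S k)
          + INR n * h * h * w ^ S k)%C.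
  + eapply Rle_trans; [apply Cmod_triangle|].
    rewrite !Cmod_mult, Cmod_R, Cmod_pow, Rabs_pos_eq by apply pos_INR.
    assert (Cmod w ^ S k <= s ^ S k) by (apply pow_incr; lra).
    pose proof (pos_INR n). pose proof (pos_INR (S k)).
    assert (0 <= Cmod h ^ 2) by nra.
    assert (0 <= s ^ k) by (apply pow_le; lra).
    apply Rle_trans with
      (s * (INR (S k) * INR n * s ^ k * Cmod h ^ 2) + INR n * Cmod h ^ 2 * s ^ S k).
    * apply Rplus_le_compat.
      -- apply Rmult_le_compat; try apply Cmod_ge_0; assumption.
      -- replace (INR n * Cmod h * Cmod h) with (INR n * Cmod h ^ 2) by ring.
         apply Rmult_le_compat_l; [nra|assumption].
    * assert (0 <= (INR (S k) + 1) * (s ^ k * s * Cmod h ^ 2)).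
      { repeat apply Rmult_le_pos; lra || nra. }
      rewrite (S_INR n). unfold n. rewrite (S_INR (S k)), <- (tech_pow_Rmult s).
      lra.
  + rewrite (S_INR n), RtoC_plus. unfold n. rewrite !Cpow_S. ring.
Qed.

Lemma sums_to_radius (c : nat -> C) (f : C -> C) (z0 : C) (r s : R) :
  sums_to c f z0 r -> 0 <= s < r ->
  Rbar_lt s (CV_radius (fun k => Cmod (c k))).
Proof.
intros Hf Hs. set (t := (s + r) / 2).
assert (Et : (z0 + t - z0)%C = t) by ring.
assert (Ht : Cmod (z0 + t - z0)%C < r).
{ rewrite Et, Cmod_R, Rabs_pos_eq; unfold t; lra. }
destruct (filterlim_bounded (K := C_AbsRing) (V := C_NormedModule)
            (sum_n (fun k => c k * RtoC t ^ k)%C)) as [M HM].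
{ exists (f (z0 + t)%C). specialize (Hf _ Ht). rewrite Et in Hf. exact Hf. }
assert (HM' : forall n, Cmod (c n * RtoC t ^ n)%C <= 2 * M).
{ intros [|n].
  - specialize (HM 0%nat). rewrite sum_O in HM.
    change (Cmod (c 0%nat * RtoC t ^ 0)%C <= M) in HM.
    pose proof (Cmod_ge_0 (c 0%nat * RtoC t ^ 0)%C). lra.
  - pose proof (HM n) as H1. pose proof (HM (S n)) as H2.
    rewrite sum_Sn in H2.
    set (u := sum_n _ n) in *.
    change (Cmod u <= M) in H1.
    change (Cmod (u + c (S n) * RtoC t ^ S n)%C <= M) in H2.
    replace (c (S n) * RtoC t ^ S n)%C
      with ((u + c (S n) * RtoC t ^ S n) + - u)%C by ring.
    eapply Rle_trans; [apply Cmod_triangle|]. rewrite Cmod_opp. lra. }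
apply Rbar_lt_le_trans with t; [unfold t; simpl; lra|].
apply (proj1 (CV_radius_bounded _)).
exists (2 * M). intros n. specialize (HM' n).
rewrite Cmod_mult, Cmod_pow, Cmod_R in HM'.
rewrite Rabs_mult, <- RPow_abs, (Rabs_pos_eq (Cmod _)) by apply Cmod_ge_0.
exact HM'.
Qed.

Lemma ex_series_of_ex_pseries (a : nat -> R) (x : R) :
  Rbar_lt (Rabs x) (CV_radius a) -> ex_series (fun n => a n * x ^ n).
Proof.
intros H. destruct (CV_radius_inside _ _ H) as [l Hl].
exists l. apply is_pseries_R. exact Hl.
Qed.

(** Summing the tangent-line errors of the powers bounds the error of the
    termwise derivative by [Cmod h ^ 2] times the second derivative of the real
    series of moduli, which converges at a radius [s] strictly between
    [Cmod (z - z0)] and [r]. *)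
Lemma sums_to_derive (c : nat -> C) (f : C -> C) (z0 : C) (r : R) :
  sums_to c f z0 r -> sums_to (C_PS_derive c) (C_derive f) z0 r.
Proof.
intros Hf z Hw.
pose proof (fun s => sums_to_radius _ _ _ _ s Hf) as Hrad0.
assert (Hfw : forall h, Cmod ((z - z0) + h)%C < r ->
  @is_series C_AbsRing C_NormedModule (fun k => c k * ((z - z0) + h) ^ k)%C (f (z + h)%C)).
{ intros h Hh. specialize (Hf (z + h)%C).
  replace (z + h - z0)%C with ((z - z0) + h)%C in Hf by ring. exact (Hf Hh). }
specialize (Hf z Hw). set (w := (z - z0)%C) in *.
set (s := (Cmod w + r) / 2).
pose proof (Cmod_ge_0 w) as Hw0.
assert (Hs : 0 <= s < r) by (unfold s; lra).
assert (Hws : Cmod w < s) by (unfold s; lra).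
pose proof (Hrad0 _ Hs) as Hrad.
set (a := fun k => Cmod (c k)) in *.
assert (Hrad' : Rbar_lt (Rabs s) (CV_radius a)) by (rewrite Rabs_pos_eq; tauto).
assert (E1 : ex_series (fun n => PS_derive a n * s ^ n)).
{ apply ex_series_of_ex_pseries. rewrite CV_radius_derive. exact Hrad'. }
assert (E2 : ex_series (fun n => PS_derive (PS_derive a) n * s ^ n)).
{ apply ex_series_of_ex_pseries. rewrite !CV_radius_derive. exact Hrad'. }
assert (El : exists l : C, @is_series C_AbsRing C_NormedModule
                        (fun n => C_PS_derive c n * w ^ n)%C l).
{ apply (ex_series_le (K := C_AbsRing) (V := C_CompleteNormedModule)
   (fun n => C_PS_derive c n * w ^ n)%C (fun n => PS_derive a n * s ^ n)); [|exact E1].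
  intros n. change (Cmod (C_PS_derive c n * w ^ n)%C <= PS_derive a n * s ^ n).
  unfold C_PS_derive, PS_derive, a.
  rewrite !Cmod_mult, Cmod_R, Cmod_pow, Rabs_pos_eq by apply pos_INR.
  apply Rmult_le_compat_l.
  - apply Rmult_le_pos; [apply pos_INR|apply Cmod_ge_0].
  - apply pow_incr; lra. }
destruct El as [l Hl]. destruct E2 as [K HK].
replace (C_derive f z) with l; [exact Hl|]. symmetry.
apply C_derive_of_quadratic_error with (K := K) (r := s - Cmod w); [lra|].
intros h Hh.
assert (Hwh : Cmod (w + h)%C <= s).
{ eapply Rle_trans; [apply Cmod_triangle|]; lra. }
pose proof (Hfw h ltac:(lra)) as S1.
pose proof Hf as S2.
(* [pred] only matters at [n = 0], where the factor [INR n] vanishes. *)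
assert (S3 : @is_series C_AbsRing C_NormedModule
  (fun n => (INR n * c n * w ^ pred n)%C) l).
{ apply (is_series_decr_1 (K := C_AbsRing) (V := C_NormedModule)).
  match goal with |- is_series _ ?v => replace v with l end; [exact Hl|].
  change (l = l + - (0 * c 0%nat * 1) :> C)%C. ring. }
pose proof (is_series_scal (K := C_AbsRing) (V := C_NormedModule) h _ _ S3) as S4.
pose proof (is_series_minus (K := C_AbsRing) (V := C_NormedModule) _ _ _ _
  (is_series_minus (K := C_AbsRing) (V := C_NormedModule) _ _ _ _ S1 S2) S4) as S5.
set (d := fun n => _) in S5.
assert (S6 : @is_series C_AbsRing C_NormedModule (fun n => d (S (S n)))
               (f (z + h) - f z - h * l)%C).
{ apply (is_series_incr_1 (K := C_AbsRing) (V := C_NormedModule) (fun n => d (S n))).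
  apply (is_series_incr_1 (K := C_AbsRing) (V := C_NormedModule) d).
  match goal with |- is_series _ ?v => replace v with
    ((f (z + h) + - f z) + - (h * l))%C end; [exact S5|].
  change ((f (z + h) + - f z) + - (h * l) = (f (z + h) - f z - h * l) +
    ((c 1%nat * ((w + h) * 1) + - (c 1%nat * (w * 1))) + - (h * (1 * c 1%nat * 1)))
    + ((c 0%nat * 1 + - (c 0%nat * 1)) + - (h * (0 * c 0%nat * 1))) :> C)%C. ring. }
refine (Cmod_series_le _ _ _ _ S6
  (is_series_scal_r (Cmod h ^ 2) _ _ HK) _).
intros n.
change (d (S (S n))) with
  ((c (S (S n)) * (w + h) ^ S (S n) + - (c (S (S n)) * w ^ S (S n)))
   + - (h * (INR (S (S n)) * c (S (S n)) * w ^ S n)))%C.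
replace (_ + - (h * _))%C with
 (c (S (S n)) * ((w + h) ^ S (S n) - w ^ S (S n) - INR (S (S n)) * h * w ^ S n))%C
 by ring.
rewrite Cmod_mult. unfold PS_derive, a.
eapply Rle_trans.
- apply Rmult_le_compat_l; [apply Cmod_ge_0|].
  apply power_difference_bound with (s := s); lra.
- apply Req_le. ring.
Qed.

(** * Holomorphic germs by iterated difference quotients *)

(** Germs at [0] from which a coefficient can be split off [n] times, the last
    quotient being bounded.  Equivalently, the germ is a polynomial of degree
    less than [n] up to [O(h^n)]; the recursive form makes stability under
    products and reciprocals a short induction, where quotients of power series
    would need estimates on recursively defined coefficients. *)
Fixpoint jet (n : nat) (f : C -> C) : Prop :=
  match n with
  | O => exists K r, 0 < r /\ forall h, Cmod h < r -> Cmod (f h) <= K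
  | S m => exists (c : C) (g : C -> C) (r : R), 0 < r /\
      (forall h, Cmod h < r -> f h = (c + h * g h)%C) /\ jet m g
  end.

Lemma jet_ext (n : nat) (f g : C -> C) (r : R) :
  0 < r -> (forall h, Cmod h < r -> f h = g h) -> jet n f -> jet n g.
Proof.
intros Hr E. destruct n as [|n]; simpl.
- intros (K & r' & Hr' & H). exists K, (Rmin r r'). split; [now apply Rmin_pos|].
  intros h Hh. rewrite <- E.
  + apply H. exact (Rlt_le_trans _ _ _ Hh (Rmin_r _ _)).
  + exact (Rlt_le_trans _ _ _ Hh (Rmin_l _ _)).
- intros (c & k & r' & Hr' & H & J). exists c, k, (Rmin r r').
  split; [now apply Rmin_pos|]. split; [|exact J].
  intros h Hh. rewrite <- E.
  + apply H. exact (Rlt_le_trans _ _ _ Hh (Rmin_r _ _)).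
  + exact (Rlt_le_trans _ _ _ Hh (Rmin_l _ _)).
Qed.

Lemma jet_S (n : nat) (f : C -> C) : jet (S n) f -> jet n f.
Proof.
revert f; induction n as [|n IH]; intros f (c & g & r & Hr & E & J).
- destruct J as (K & r' & Hr' & H).
  exists (Cmod c + Rabs K), (Rmin (Rmin r r') 1).
  split; [repeat apply Rmin_pos; lra|]. intros h Hh.
  assert (Cmod h < r).
  { eapply Rlt_le_trans; [exact Hh|]. eapply Rle_trans; apply Rmin_l. }
  assert (Cmod h < r').
  { eapply Rlt_le_trans; [exact Hh|]. eapply Rle_trans; [apply Rmin_l|apply Rmin_r]. }
  assert (Cmod h < 1) by (eapply Rlt_le_trans; [exact Hh|apply Rmin_r]).
  rewrite E by assumption. eapply Rle_trans; [apply Cmod_triangle|].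
  rewrite Cmod_mult. pose proof (H h ltac:(assumption)).
  pose proof (Cmod_ge_0 h). pose proof (Cmod_ge_0 (g h)). pose proof (Rle_abs K).
  nra.
- exists c, g, r. auto.
Qed.

Lemma jet_le (m n : nat) (f : C -> C) : (m <= n)%nat -> jet n f -> jet m f.
Proof. induction 1 as [|n _ IH]; [easy|]. intros J. apply IH, jet_S, J. Qed.

Lemma jet_const (n : nat) (c : C) : jet n (fun _ => c).
Proof.
revert c; induction n as [|n IH]; intros c; simpl.
- exists (Cmod c), 1. split; [lra|]. intros; lra.
- exists c, (fun _ => 0%C), 1. split; [lra|]. split; [intros; ring|apply IH].
Qed.

Lemma jet_var (n : nat) : jet n (fun h => h).
Proof.
destruct n as [|n]; simpl.
- exists 1, 1. split; [lra|]. intros; lra.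
- exists 0%C, (fun _ => 1%C), 1. split; [lra|]. split; [intros; ring|apply jet_const].
Qed.

Lemma jet_plus (n : nat) (f g : C -> C) :
  jet n f -> jet n g -> jet n (fun h => f h + g h)%C.
Proof.
revert f g; induction n as [|n IH]; intros f g.
- intros (K & r & Hr & H) (K' & r' & Hr' & H').
  exists (K + K'), (Rmin r r'). split; [now apply Rmin_pos|]. intros h Hh.
  eapply Rle_trans; [apply Cmod_triangle|].
  apply Rplus_le_compat; [apply H|apply H'].
  + exact (Rlt_le_trans _ _ _ Hh (Rmin_l _ _)).
  + exact (Rlt_le_trans _ _ _ Hh (Rmin_r _ _)).
- intros (c & k & r & Hr & E & J) (c' & k' & r' & Hr' & E' & J').
  exists (c + c')%C, (fun h => k h + k' h)%C, (Rmin r r').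
  split; [now apply Rmin_pos|]. split; [|now apply IH].
  intros h Hh. rewrite E, E'.
  + ring.
  + exact (Rlt_le_trans _ _ _ Hh (Rmin_r _ _)).
  + exact (Rlt_le_trans _ _ _ Hh (Rmin_l _ _)).
Qed.

Lemma jet_mult (n : nat) (f g : C -> C) :
  jet n f -> jet n g -> jet n (fun h => f h * g h)%C.
Proof.
revert f g; induction n as [|n IH]; intros f g.
- intros (K & r & Hr & H) (K' & r' & Hr' & H').
  exists (K * K'), (Rmin r r'). split; [now apply Rmin_pos|]. intros h Hh.
  rewrite Cmod_mult.
  apply Rmult_le_compat; try apply Cmod_ge_0; [apply H|apply H'].
  + exact (Rlt_le_trans _ _ _ Hh (Rmin_l _ _)).
  + exact (Rlt_le_trans _ _ _ Hh (Rmin_r _ _)).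
- intros (c & k & r & Hr & E & J) (c' & k' & r' & Hr' & E' & J').
  exists (c * c')%C, (fun h => c * k' h + (c' * k h + h * (k h * k' h)))%C, (Rmin r r').
  split; [now apply Rmin_pos|]. split.
  + intros h Hh. rewrite E, E'.
    * ring.
    * exact (Rlt_le_trans _ _ _ Hh (Rmin_r _ _)).
    * exact (Rlt_le_trans _ _ _ Hh (Rmin_l _ _)).
  + pose proof (jet_const n). pose proof (jet_var n).
    repeat first [apply jet_plus | apply IH | assumption | apply jet_const].
Qed.

Lemma Cmod_triangle_inv (a b : C) : Cmod a - Cmod b <= Cmod (a + b)%C.
Proof.
replace a with ((a + b) + - b)%C at 1 by ring.
pose proof (Cmod_triangle (a + b) (- b)) as H. rewrite Cmod_opp in H. lra.
Qed.

(** One order is lost only because continuity is needed to keep [f] away from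
    [0] near the origin.  The induction rests on
    [1 / (c + h g) = 1 / c - h g / (c f)]: the right side involves [1 / f] at
    the previous order only. *)
Lemma jet_inv (n : nat) (f : C -> C) :
  f 0%C <> 0%C -> jet (S n) f -> jet n (fun h => / f h)%C.
Proof.
intros Hf0 Jf.
assert (Hlow : exists d r, 0 < d /\ 0 < r /\ forall h, Cmod h < r -> d <= Cmod (f h)).
{ assert (J1 : jet 1 f).
  { apply (jet_le 1 (S n)); [lia|exact Jf]. }
  destruct J1 as (c & g & r & Hr & E & (K & r' & Hr' & H)).
  assert (Ec : f 0%C = c).
  { rewrite E; [ring|]. rewrite Cmod_0. exact Hr. }
  rewrite Ec in Hf0. apply Cmod_gt_0 in Hf0.
  pose proof (Rabs_pos K) as HK0. pose proof (Rle_abs K) as HK1.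
  set (d := Cmod c / 2 / (Rabs K + 1)).
  assert (Hd : 0 < d) by (apply Rdiv_lt_0_compat; lra).
  exists (Cmod c / 2), (Rmin d (Rmin r r')).
  split; [lra|]. split; [repeat apply Rmin_pos; assumption|].
  intros h Hh.
  pose proof (Rlt_le_trans _ _ _ Hh (Rmin_l _ _)) as H1.
  pose proof (Rlt_le_trans _ _ _ Hh (Rmin_r _ _)) as H2.
  pose proof (Rlt_le_trans _ _ _ H2 (Rmin_l _ _)) as H3.
  pose proof (Rlt_le_trans _ _ _ H2 (Rmin_r _ _)) as H4.
  rewrite E by assumption. eapply Rle_trans; [|apply Cmod_triangle_inv].
  rewrite Cmod_mult. specialize (H h H4).
  pose proof (Cmod_ge_0 h). pose proof (Cmod_ge_0 (g h)).
  assert (Cmod h * (Rabs K + 1) <= Cmod c / 2).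
  { replace (Cmod c / 2) with (d * (Rabs K + 1)) by (unfold d; field; lra).
    apply Rmult_le_compat_r; lra. }
  nra. }
destruct Hlow as (d & r0 & Hd & Hr0 & Hlow).
assert (Hnz : forall h, Cmod h < r0 -> f h <> 0%C).
{ intros h Hh. apply Cmod_gt_0. specialize (Hlow h Hh). lra. }
clear Hf0. apply jet_S in Jf. induction n as [|n IH].
- exists (/ d), r0. split; [exact Hr0|]. intros h Hh.
  rewrite Cmod_inv by now apply Hnz. apply Rinv_le_contravar; auto.
- pose proof (IH (jet_S _ _ Jf)) as J'.
  destruct Jf as (c & g & r & Hr & E & J).
  assert (Hc : c <> 0%C).
  { replace c with (f 0%C).
    - apply Hnz. rewrite Cmod_0. exact Hr0.
    - rewrite E; [ring|]. rewrite Cmod_0. exact Hr. }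
  exists (/ c)%C, (fun h => (- / c) * (g h * / f h))%C, (Rmin r r0).
  split; [now apply Rmin_pos|]. split.
  + intros h Hh.
    pose proof (Hnz h (Rlt_le_trans _ _ _ Hh (Rmin_r _ _))) as Hh0.
    rewrite E in * by exact (Rlt_le_trans _ _ _ Hh (Rmin_l _ _)).
    field. split; assumption.
  + repeat apply jet_mult; try assumption. apply jet_const.
Qed.

(** Expansions of every order at every point, with no uniformity in the point:
    enough for the maximum principle, and preserved by products, quotients and
    removal of singularities without any integral. *)
Definition holomorphic (f : C -> C) : Prop :=
  forall z0, in_disk z0 -> forall n, jet n (fun h => f (z0 + h)%C).

Lemma in_disk_open (z0 h : C) :
  in_disk z0 -> Cmod h < 1 - Cmod z0 -> in_disk (z0 + h)%C.
Proof.
unfold in_disk; intros. pose proof (Cmod_triangle z0 h). lra.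
Qed.

Lemma holomorphic_ext (f g : C -> C) :
  (forall z, in_disk z -> f z = g z) -> holomorphic f -> holomorphic g.
Proof.
intros E Hf z0 Hz0 n.
apply (jet_ext n (fun h => f (z0 + h)%C) _ (1 - Cmod z0)).
- unfold in_disk in Hz0; lra.
- intros h Hh. apply E. now apply in_disk_open.
- now apply Hf.
Qed.

Lemma holomorphic_const (c : C) : holomorphic (fun _ => c).
Proof. intros z0 _ n. apply jet_const. Qed.

Lemma holomorphic_id : holomorphic (fun z => z).
Proof. intros z0 _ n. apply jet_plus; [apply jet_const|apply jet_var]. Qed.

Lemma holomorphic_plus (f g : C -> C) :
  holomorphic f -> holomorphic g -> holomorphic (fun z => f z + g z)%C.
Proof.
intros Hf Hg z0 Hz0 n.
exact (jet_plus n _ _ (Hf z0 Hz0 n) (Hg z0 Hz0 n)).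
Qed.

Lemma holomorphic_mult (f g : C -> C) :
  holomorphic f -> holomorphic g -> holomorphic (fun z => f z * g z)%C.
Proof.
intros Hf Hg z0 Hz0 n.
exact (jet_mult n _ _ (Hf z0 Hz0 n) (Hg z0 Hz0 n)).
Qed.

Lemma holomorphic_inv (f : C -> C) :
  (forall z, in_disk z -> f z <> 0%C) ->
  holomorphic f -> holomorphic (fun z => / f z)%C.
Proof.
intros Hnz Hf z0 Hz0 n.
apply (jet_inv n (fun h => f (z0 + h)%C)); [|now apply Hf].
apply Hnz. now rewrite Cplus_0_r.
Qed.

Lemma holomorphic_pow (k : nat) : holomorphic (fun z => z ^ k)%C.
Proof.
induction k as [|k IH]; [exact (holomorphic_const 1)|].
apply (holomorphic_mult (fun z => z) (fun z => z ^ k)%C holomorphic_id IH).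
Qed.

Definition slope (f : C -> C) (z : C) : C :=
  if Ceq_dec z 0 then C_derive f 0 else ((f z - f 0) / z)%C.

Lemma slope_spec (f : C -> C) (z : C) : f z = (f 0 + z * slope f z)%C.
Proof.
unfold slope. destruct (Ceq_dec z 0) as [->|Hz]; [ring|]. field. exact Hz.
Qed.

(** Removal of singularities.  At [0] the quotient split off by the expansion of
    [f] is the slope off the origin; two extra orders make that quotient
    Lipschitz at the origin, so that its value there is the derivative of [f]. *)
Lemma holomorphic_slope (f : C -> C) : holomorphic f -> holomorphic (slope f).
Proof.
intros Hf z0 Hz0 n. destruct (Ceq_dec z0 0) as [->|Hz0'].
- destruct (Hf 0%C Hz0 (S (S n))) as (c & g & r & Hr & E & Jg).
  apply jet_ext with (f := g) (r := r); [exact Hr| |exact (jet_S _ _ Jg)].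
  intros h Hh. rewrite Cplus_0_l.
  assert (Ec : f 0%C = c).
  { specialize (E 0%C). rewrite Cplus_0_l, Cmod_0 in E. rewrite E by exact Hr. ring. }
  unfold slope. destruct (Ceq_dec h 0) as [->|Hh'].
  + symmetry.
    assert (J1 : jet 1 g).
    { apply (jet_le 1 (S n)); [lia|exact Jg]. }
    destruct J1 as (c' & g' & r' & Hr' & E' & (K & r'' & Hr'' & H)).
    apply C_derive_of_quadratic_error with (K := K) (r := Rmin r (Rmin r' r'')).
    { repeat apply Rmin_pos; assumption. }
    intros h Hh1.
    pose proof (Rlt_le_trans _ _ _ Hh1 (Rmin_l _ _)) as H1.
    pose proof (Rlt_le_trans _ _ _ Hh1 (Rmin_r _ _)) as H2.
    pose proof (Rlt_le_trans _ _ _ H2 (Rmin_l _ _)) as H3.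
    pose proof (Rlt_le_trans _ _ _ H2 (Rmin_r _ _)) as H4.
    rewrite Ec, (E h H1), (E' h H3), (E' 0%C) by (rewrite Cmod_0; assumption).
    replace (_ - _ - _)%C with (g' h * (h * h))%C by ring.
    rewrite !Cmod_mult. specialize (H h H4). pose proof (Cmod_ge_0 h). nra.
  + rewrite Ec. specialize (E h Hh). rewrite Cplus_0_l in E. rewrite E.
    field. exact Hh'.
- apply jet_ext with (f := fun h => ((f (z0 + h) + - f 0) * / (z0 + h))%C)
    (r := Cmod z0).
  + now apply Cmod_gt_0.
  + intros h Hh. unfold slope. destruct (Ceq_dec (z0 + h) 0) as [Eh|_].
    * exfalso. replace h with (- z0)%C in Hh.
      -- rewrite Cmod_opp in Hh. lra.
      -- replace h with ((z0 + h) - z0)%C by ring. rewrite Eh. ring.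
    * reflexivity.
  + apply jet_mult.
    * apply jet_plus; [now apply Hf|apply jet_const].
    * apply (jet_inv n (fun h => (z0 + h)%C)); [|now apply holomorphic_id].
      now rewrite Cplus_0_r.
Qed.

(** * Power series are holomorphic *)

Lemma is_series_C_unique (x : nat -> C) (l l' : C) :
  @is_series C_AbsRing C_NormedModule x l ->
  @is_series C_AbsRing C_NormedModule x l' -> l = l'.
Proof.
intros H H'.
exact (filterlim_locally_unique (K := C_AbsRing) (V := C_NormedModule) _ _ _ H H').
Qed.

Lemma is_series_power_0 (c : nat -> C) :
  @is_series C_AbsRing C_NormedModule (fun k => c k * 0 ^ k)%C (c 0%nat).
Proof.
apply filterlim_ext with (f := fun _ => c 0%nat).
- intros n. induction n as [|n IH].
  + rewrite sum_O. simpl. now rewrite Cmult_1_r.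
  + rewrite sum_Sn, <- IH. change (c 0%nat = c 0%nat + c (S n) * (0 * 0 ^ n))%C. ring.
- apply filterlim_const.
Qed.

Lemma sums_to_centre (c : nat -> C) (f : C -> C) (z0 : C) (r : R) :
  0 < r -> sums_to c f z0 r -> f z0 = c 0%nat.
Proof.
intros Hr H. assert (E : (z0 - z0)%C = 0%C) by ring.
specialize (H z0). rewrite E, Cmod_0 in H.
exact (is_series_C_unique _ _ _ (H Hr) (is_series_power_0 c)).
Qed.

(** Passing to the difference quotient shifts the coefficients; this is how
    Taylor coefficients are read off below. *)
Lemma sums_to_slope (c : nat -> C) (f : C -> C) (r : R) :
  0 < r -> sums_to c f 0 r -> sums_to (fun k => c (S k)) (slope f) 0 r.
Proof.
intros Hr H z Hz.
replace (z - 0)%C with z in * by ring.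
unfold slope. destruct (Ceq_dec z 0) as [->|Hz0].
- rewrite (sums_to_centre _ _ _ _ Hr (sums_to_derive _ _ _ _ H)).
  replace (C_PS_derive c 0) with (c 1%nat) by (unfold C_PS_derive; simpl; ring).
  apply (is_series_power_0 (fun k => c (S k))).
- rewrite (sums_to_centre _ _ _ _ Hr H).
  specialize (H z). replace (z - 0)%C with z in H by ring. specialize (H Hz).
  assert (H1 : @is_series C_AbsRing C_NormedModule
    (fun k => c (S k) * z ^ S k)%C (f z - c 0%nat)%C).
  { apply (is_series_incr_1 (K := C_AbsRing) (V := C_NormedModule)
             (fun k => c k * z ^ k)%C).
    match goal with |- is_series _ ?v => replace v with (f z) end; [exact H|].
    change (f z = (f z - c 0%nat) + c 0%nat * 1)%C. ring. }
  pose proof (is_series_scal (K := C_AbsRing) (V := C_NormedModule) (/ z)%C _ _ H1) as H2.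
  match goal with |- is_series _ ?v =>
    replace v with (/ z * (f z - c 0%nat))%C by (unfold Cdiv; ring) end.
  revert H2. apply is_series_ext. intros n.
  change ((/ z * (c (S n) * (z * z ^ n)))%C = (c (S n) * z ^ n)%C). field. exact Hz0.
Qed.

Lemma sums_to_jet (c : nat -> C) (f : C -> C) (r : R) (n : nat) :
  0 < r -> sums_to c f 0 r -> jet n f.
Proof.
intros Hr. revert c f; induction n as [|n IH]; intros c f H.
- assert (Hs : 0 <= r / 2 < r) by lra.
  pose proof (sums_to_radius _ _ _ _ _ H Hs) as Hrad.
  assert (Hrad' : Rbar_lt (Rabs (r / 2)) (CV_radius (fun k => Cmod (c k))))
    by (rewrite Rabs_pos_eq; tauto).
  destruct (ex_series_of_ex_pseries _ _ Hrad') as [K HK].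
  exists K, (r / 2). split; [lra|]. intros h Hh.
  specialize (H h). replace (h - 0)%C with h in H by ring.
  refine (Cmod_series_le _ _ _ _ (H ltac:(lra)) HK _).
  intros k. rewrite Cmod_mult, Cmod_pow.
  apply Rmult_le_compat_l; [apply Cmod_ge_0|].
  apply pow_incr. pose proof (Cmod_ge_0 h). lra.
- exists (f 0%C), (slope f), r. split; [exact Hr|]. split.
  + intros h _. apply slope_spec.
  + apply (IH _ _ (sums_to_slope _ _ _ Hr H)).
Qed.

Definition has_power_series (f : C -> C) : Prop :=
  forall z0, in_disk z0 -> exists c r, 0 < r /\ sums_to c f z0 r.

Lemma analytic_has_power_series (f : C -> C) :
  analytic_in_disk f -> has_power_series f.
Proof.
intros Hf z0 Hz0. destruct (Hf z0 Hz0) as (c & r & Hr & H).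
exists c, r. split; [exact Hr|]. intros z Hz. apply is_pseries_C. now apply H.
Qed.

Lemma has_power_series_derive (f : C -> C) :
  has_power_series f -> has_power_series (C_derive f).
Proof.
intros Hf z0 Hz0. destruct (Hf z0 Hz0) as (c & r & Hr & H).
exists (C_PS_derive c), r. split; [exact Hr|]. now apply sums_to_derive.
Qed.

Lemma has_power_series_holomorphic (f : C -> C) :
  has_power_series f -> holomorphic f.
Proof.
intros Hf z0 Hz0 n. destruct (Hf z0 Hz0) as (c & r & Hr & H).
apply (sums_to_jet c _ r n Hr). intros h Hh.
replace (h - 0)%C with h in * by ring.
specialize (H (z0 + h)%C). replace (z0 + h - z0)%C with h in H by ring.
now apply H.
Qed.

(** * The maximum principle *)

Lemma Cplus_sub_cancel (a b : C) : (a + (b - a))%C = b.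
Proof. ring. Qed.

(** The one-sided Lipschitz hypothesis is a convenient form of upper
    semicontinuity.  If no point were maximal, every point would have a
    neighbourhood on which [u] stays below one of its values; of the finitely
    many values that come from a finite subcover, the largest would lie below
    itself. *)
Lemma closed_disk_max (u : C -> R) (rho : R) :
  0 <= rho ->
  (forall z, Cmod z <= rho -> exists K r, 0 <= K /\ 0 < r /\
     forall h, Cmod h < r -> u (z + h)%C <= u z + K * Cmod h) ->
  exists z, Cmod z <= rho /\ forall w, Cmod w <= rho -> u w <= u z.
Proof.
intros Hrho Hu. apply NNPP. intros Hno.
assert (Hup : forall z, Cmod z <= rho -> exists w, Cmod w <= rho /\ u z < u w).
{ intros z Hz. apply NNPP. intros H. apply Hno. exists z. split; [exact Hz|].
  intros w Hw. apply Rnot_lt_le. intros Hlt. apply H. now exists w. }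
(* A gauge [d] is good at [t] if [u] stays below one of its values near [t]; at
   points outside the disk it is good because it avoids the disk. *)
set (good := fun (t : Compactness.Tn 2 R) (d : R) =>
  exists b, Cmod b <= rho /\ forall x1 x2 : R, close_n 2 d (x1, (x2, tt)) t ->
    Cmod (x1, x2) <= rho -> u (x1, x2) < u b).
assert (Hgood : forall t, exists d : posreal, good t d).
{ intros (t1, (t2, [])).
  set (t := (t1, t2) : C).
  assert (Hclose : forall d x1 x2, close_n 2 d (x1, (x2, tt)) (t1, (t2, tt)) ->
            Cmod ((x1, x2) - t)%C < 2 * d).
  { intros d x1 x2 (H1 & H2 & _).
    eapply Rle_lt_trans; [apply Cmod_2Rmax|]. simpl.
    assert (Hs : sqrt 2 <= 2).
    { rewrite <- (sqrt_square 2) at 2 by lra. apply sqrt_le_1; lra. }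
    assert (Hm : Rmax (Rabs (x1 + - t1)) (Rabs (x2 + - t2)) < d)
      by (apply Rmax_lub_lt; assumption).
    pose proof (Rabs_pos (x1 + - t1)).
    pose proof (Rmax_l (Rabs (x1 + - t1)) (Rabs (x2 + - t2))). nra. }
  destruct (Rle_or_lt (Cmod t) rho) as [Ht|Ht].
  - destruct (Hup t Ht) as (b & Hb & Hlt).
    destruct (Hu t Ht) as (K & r & HK & Hr & H).
    assert (Hd : 0 < Rmin r ((u b - u t) / (K + 1)) / 2).
    { apply Rdiv_lt_0_compat; [|lra]. apply Rmin_pos; [exact Hr|].
      apply Rdiv_lt_0_compat; lra. }
    exists (mkposreal _ Hd). exists b. split; [exact Hb|].
    intros x1 x2 Hx Hxr. apply Hclose in Hx. simpl in Hx.
    rewrite <- (Cplus_sub_cancel t (x1, x2)).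
    set (h := ((x1, x2) - t)%C) in *.
    assert (H1 : Cmod h < r).
    { pose proof (Rmin_l r ((u b - u t) / (K + 1))). lra. }
    assert (H2 : Cmod h < (u b - u t) / (K + 1)).
    { pose proof (Rmin_r r ((u b - u t) / (K + 1))). lra. }
    apply (Rmult_lt_compat_r (K + 1)) in H2; [|lra].
    unfold Rdiv in H2. rewrite Rmult_assoc, Rinv_l in H2 by lra.
    specialize (H h H1). pose proof (Cmod_ge_0 h). nra.
  - assert (Hd : 0 < (Cmod t - rho) / 2) by lra.
    exists (mkposreal _ Hd). exists 0%C. rewrite Cmod_0. split; [exact Hrho|].
    intros x1 x2 Hx Hxr. apply Hclose in Hx. simpl in Hx. exfalso.
    pose proof (Cmod_triangle_inv t ((x1, x2) - t)) as H1.
    rewrite Cplus_sub_cancel in H1.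
    lra. }
pose (delta := fun t => proj1_sig (constructive_indefinite_description _ (Hgood t))).
assert (Hdelta : forall t, good t (delta t)).
{ intros t. exact (proj2_sig (constructive_indefinite_description _ (Hgood t))). }
apply (compactness_list 2 (- rho, (- rho, tt)) (rho, (rho, tt)) delta).
intros (l & Hl).
assert (Hbest : exists b, Cmod b <= rho /\ forall t, In t l -> forall x1 x2 : R,
   close_n 2 (delta t) (x1, (x2, tt)) t -> Cmod (x1, x2) <= rho -> u (x1, x2) < u b).
{ clear Hl. induction l as [|t l (b & Hb & H)].
  - exists 0%C. rewrite Cmod_0. split; [exact Hrho|]. intros t [].
  - destruct (Hdelta t) as (b' & Hb' & H').
    destruct (Rle_or_lt (u b) (u b')) as [Hc|Hc].
    + exists b'. split; [exact Hb'|]. intros s [<-|Hs] x1 x2 Hx Hxr; [now apply H'|].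
      specialize (H s Hs x1 x2 Hx Hxr). lra.
    + exists b. split; [exact Hb|]. intros s [<-|Hs] x1 x2 Hx Hxr.
      * specialize (H' x1 x2 Hx Hxr). lra.
      * now apply (H s Hs). }
destruct Hbest as ((b1, b2) & Hb & H).
destruct (Hl (b1, (b2, tt))) as (t & Ht & _ & Hc).
{ pose proof (Rmax_Cmod (b1, b2)) as Hm. simpl in Hm.
  pose proof (Rmax_l (Rabs b1) (Rabs b2)). pose proof (Rmax_r (Rabs b1) (Rabs b2)).
  assert (B1 : Rabs b1 <= rho) by lra. assert (B2 : Rabs b2 <= rho) by lra.
  apply Rabs_le_between in B1, B2. simpl. auto. }
exact (Rlt_irrefl _ (H t Ht b1 b2 Hc Hb)).
Qed.

Lemma holomorphic_lipschitz_at (f : C -> C) (z : C) :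
  holomorphic f -> in_disk z -> exists K r, 0 <= K /\ 0 < r /\
    forall h, Cmod h < r -> Cmod (f (z + h) - f z)%C <= K * Cmod h.
Proof.
intros Hf Hz. destruct (Hf z Hz 1%nat) as (c & g & r & Hr & E & (K & r' & Hr' & H)).
exists (Rabs K), (Rmin r r'). split; [apply Rabs_pos|]. split; [now apply Rmin_pos|].
intros h Hh.
assert (Ec : f z = c).
{ specialize (E 0%C). rewrite Cplus_0_r, Cmod_0 in E. rewrite E by exact Hr. ring. }
rewrite Ec, (E h) by exact (Rlt_le_trans _ _ _ Hh (Rmin_l _ _)).
replace (c + h * g h - c)%C with (g h * h)%C by ring.
rewrite Cmod_mult. apply Rmult_le_compat_r; [apply Cmod_ge_0|].
eapply Rle_trans; [|apply Rle_abs]. apply H.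
exact (Rlt_le_trans _ _ _ Hh (Rmin_r _ _)).
Qed.

Lemma Re_le_Cmod (z : C) : Re z <= Cmod z.
Proof. eapply Rle_trans; [apply Rle_abs|apply re_le_Cmod]. Qed.

(** Perturb [Re U] to [u z = Re (U z) + eps * Cmod z ^ 2].  At an interior point
    [z0] the mean of [u] over [z0 + t], [z0 - t], [z0 + i t], [z0 - i t] exceeds
    [u z0] by [eps * t ^ 2 + O(t ^ 4)], because these four points cancel the
    terms of degree 1, 2 and 3 of [U]; so the maximum of [u] over the closed
    disk is attained on the circle. *)
Lemma max_principle_Re (U : C -> C) (rho M : R) :
  holomorphic U -> 0 <= rho < 1 ->
  (forall z, Cmod z = rho -> Re (U z) <= M) ->
  forall w, Cmod w <= rho -> Re (U w) <= M.
Proof.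
intros HU Hrho Hbd w Hw. apply le_epsilon. intros eps Heps.
set (u := fun z => Re (U z) + eps * Cmod z ^ 2).
destruct (closed_disk_max u rho) as (z0 & Hz0 & Hmax); [lra| |].
{ intros z Hz. assert (Hzd : in_disk z) by (unfold in_disk; lra).
  destruct (holomorphic_lipschitz_at U z HU Hzd) as (K & r & HK & Hr & H).
  exists (K + 3 * eps), (Rmin r 1). split; [lra|]. split; [apply Rmin_pos; lra|].
  intros h Hh. unfold u.
  pose proof (Rlt_le_trans _ _ _ Hh (Rmin_l _ _)) as H1.
  pose proof (Rlt_le_trans _ _ _ Hh (Rmin_r _ _)) as H2.
  specialize (H h H1). pose proof (Re_le_Cmod (U (z + h) - U z)%C) as H3.
  unfold Cminus in H3. rewrite re_plus, re_opp in H3. fold (U (z + h) - U z)%C in H3.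
  pose proof (Cmod_triangle z h). pose proof (Cmod_ge_0 z). pose proof (Cmod_ge_0 h).
  pose proof (Cmod_ge_0 (z + h)%C).
  assert (Cmod (z + h)%C ^ 2 <= Cmod z ^ 2 + 3 * Cmod h).
  { apply Rle_trans with ((Cmod z + Cmod h) ^ 2); [apply pow_incr; lra|]. nra. }
  nra. }
assert (Hwu : Re (U w) <= u z0).
{ eapply Rle_trans; [|apply Hmax, Hw]. unfold u.
  assert (0 <= eps * Cmod w ^ 2); [|lra]. apply Rmult_le_pos; [lra|].
  apply pow2_ge_0. }
destruct (Req_dec (Cmod z0) rho) as [Heq|Hneq].
{ eapply Rle_trans; [exact Hwu|]. unfold u. specialize (Hbd z0 Heq).
  rewrite Heq. assert (rho ^ 2 <= 1) by nra. nra. }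
exfalso.
destruct (HU z0 ltac:(unfold in_disk; lra) 4%nat)
  as (c0 & g0 & r0 & Hr0 & E0 & c1 & g1 & r1 & Hr1 & E1 & c2 & g2 & r2 & Hr2 & E2
      & c3 & g3 & r3 & Hr3 & E3 & K & r4 & Hr4 & H).
set (d := Rmin (Rmin (Rmin r0 r1) (Rmin r2 r3)) (Rmin r4 (Rmin (rho - Cmod z0) (Rmin 1 (eps / (Rabs K + 1)))))).
assert (Hd : 0 < d).
{ pose proof (Rabs_pos K). unfold d. repeat apply Rmin_pos; try lra.
  apply Rdiv_lt_0_compat; lra. }
set (t := d / 2). assert (Ht : 0 < t < d) by (unfold t; lra).
assert (Hall : t < r0 /\ t < r1 /\ t < r2 /\ t < r3 /\ t < r4 /\ t < rho - Cmod z0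
  /\ t < 1 /\ t < eps / (Rabs K + 1)).
{ destruct Ht as [_ Ht]. apply Rlt_gt in Ht. unfold d in Ht.
  repeat match goal with H : Rmin _ _ > _ |- _ =>
    apply Rmin_Rgt_l in H; destruct H end. repeat split; lra. }
destruct Hall as (L0 & L1 & L2 & L3 & L4 & L5 & L6 & L7).
(* Order 4 is what makes the error [O(t ^ 4)] negligible against [eps * t ^ 2]. *)
assert (Exp : forall h, Cmod h = t ->
  U (z0 + h)%C = (c0 + h * (c1 + h * (c2 + h * (c3 + h * g3 h))))%C /\
  Cmod (g3 h) <= K /\ u (z0 + h)%C <= u z0).
{ intros h Hh. split; [|split].
  - rewrite E0, E1, E2, E3 by lra. reflexivity.
  - apply H. lra.
  - apply Hmax. pose proof (Cmod_triangle z0 h). lra. }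
assert (Mt : Cmod t = t) by (rewrite Cmod_R, Rabs_pos_eq; lra).
destruct (Exp t Mt) as (Ea & Ka & Ua).
destruct (Exp (- t)%C) as (Eb & Kb & Ub); [now rewrite Cmod_opp|].
destruct (Exp (Ci * t)%C) as (Ec & Kc & Uc); [rewrite Cmod_mult, Cmod_Ci; lra|].
destruct (Exp (- (Ci * t))%C) as (Ed & Kd & Ud);
  [rewrite Cmod_opp, Cmod_mult, Cmod_Ci; lra|].
assert (Ez : U z0 = c0).
{ specialize (E0 0%C). rewrite Cplus_0_r, Cmod_0 in E0. rewrite E0 by exact Hr0. ring. }
unfold u in Ua, Ub, Uc, Ud. rewrite Ea in Ua. rewrite Eb in Ub. rewrite Ec in Uc.
rewrite Ed in Ud. rewrite Ez in *.
rewrite !Cmod2_alt in *.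
pose proof (proj1 (Rabs_le_between _ _) (Rle_trans _ _ _ (re_le_Cmod _) Ka)) as Ga.
pose proof (proj1 (Rabs_le_between _ _) (Rle_trans _ _ _ (re_le_Cmod _) Kb)) as Gb.
pose proof (proj1 (Rabs_le_between _ _) (Rle_trans _ _ _ (re_le_Cmod _) Kc)) as Gc.
pose proof (proj1 (Rabs_le_between _ _) (Rle_trans _ _ _ (re_le_Cmod _) Kd)) as Gd.
destruct (g3 t) as [a1 a2], (g3 (- t)%C) as [b1 b2], (g3 (Ci * t)%C) as [d1 d2],
  (g3 (- (Ci * t))%C) as [e1 e2], c0 as [p0 q0], c1 as [p1 q1], c2 as [p2 q2],
  c3 as [p3 q3], z0 as [x y].
simpl in Ua, Ub, Uc, Ud, Ga, Gb, Gc, Gd.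
assert (Hsum : 4 * eps * t ^ 2 + t ^ 4 * (a1 + b1 + d1 + e1) <= 0).
{ lra. }
assert (HK2 : K * t ^ 2 < eps).
{ pose proof (Rabs_pos K). pose proof (Rle_abs K).
  apply (Rmult_lt_compat_r (Rabs K + 1)) in L7; [|lra].
  unfold Rdiv in L7. rewrite Rmult_assoc, Rinv_l in L7 by lra. nra. }
assert (Hq : 0 < t ^ 2) by (apply pow_lt; lra).
replace (t ^ 4) with (t ^ 2 * t ^ 2) in Hsum by ring.
set (q := t ^ 2) in *. set (S := a1 + b1 + d1 + e1) in *.
assert (HS : - (4 * K) <= S) by (unfold S; lra).
assert (0 < q * (4 * eps + q * S)); [|nra].
apply Rmult_lt_0_compat; [exact Hq|]. nra.
Qed.

Lemma Cmod2_Re (z : C) : Re (z * Cconj z)%C = Cmod z ^ 2.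
Proof. rewrite <- Cmod2_conj. apply re_RtoC. Qed.

(** Apply the real-part version to [U] rotated so that its value at [w] becomes
    nonnegative. *)
Lemma max_principle_Cmod (U : C -> C) (rho M : R) :
  holomorphic U -> 0 <= rho < 1 ->
  (forall z, Cmod z = rho -> Cmod (U z) <= M) ->
  forall w, Cmod w <= rho -> Cmod (U w) <= M.
Proof.
intros HU Hrho Hbd w Hw.
assert (HM : 0 <= M).
{ eapply Rle_trans; [apply Cmod_ge_0|apply (Hbd rho)].
  rewrite Cmod_R, Rabs_pos_eq; lra. }
pose proof (max_principle_Re (fun z => (U z * Cconj (U w))%C) rho
  (M * Cmod (U w))) as H.
specialize (H (holomorphic_mult _ _ HU (holomorphic_const _)) Hrho).
assert (H1 : Re (U w * Cconj (U w))%C <= M * Cmod (U w)).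
{ apply H; [|exact Hw]. intros z Hz. eapply Rle_trans; [apply Re_le_Cmod|].
  rewrite Cmod_mult, Cmod_conj. apply Rmult_le_compat_r; [apply Cmod_ge_0|].
  now apply Hbd. }
rewrite Cmod2_Re in H1. pose proof (Cmod_ge_0 (U w)). nra.
Qed.

(** * Taylor expansions at the origin *)

Definition taylor_poly (c : nat -> C) (n : nat) (z : C) : C :=
  sum_n (fun k => c k * z ^ k)%C n.

Lemma taylor_poly_0 (c : nat -> C) (z : C) : taylor_poly c 0 z = c 0%nat.
Proof. unfold taylor_poly. rewrite sum_O. simpl. ring. Qed.

Lemma taylor_poly_S (c : nat -> C) (n : nat) (z : C) :
  taylor_poly c (S n) z = (taylor_poly c n z + c (S n) * z ^ S n)%C.
Proof. unfold taylor_poly. rewrite sum_Sn. reflexivity. Qed.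

(** The remainder is required on the whole disk: this is what lets information
    at the origin and information on a circle meet in the maximum principle. *)
Definition expands (f : C -> C) (c : nat -> C) (n : nat) : Prop :=
  exists H, holomorphic H /\
    forall z, in_disk z -> f z = (taylor_poly c n z + z ^ S n * H z)%C.

Lemma expands_pred (f : C -> C) (c : nat -> C) (n : nat) :
  expands f c (S n) -> expands f c n.
Proof.
intros (H & HH & E). exists (fun z => c (S n) + z * H z)%C. split.
- apply (holomorphic_plus (fun _ => c (S n))); [apply holomorphic_const|].
  apply (holomorphic_mult (fun z => z)); [apply holomorphic_id|exact HH].
- intros z Hz. rewrite (E z Hz), taylor_poly_S, !Cpow_S. ring.
Qed.

Lemma expands_of_sums_to (f : C -> C) (c : nat -> C) (r : R) (n : nat) :
  holomorphic f -> 0 < r -> sums_to c f 0 r -> expands f c n.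
Proof.
intros Hf Hr Hc.
(* The induction needs the power series of the remainder as well. *)
cut (exists H, holomorphic H /\ sums_to (fun k => c (S n + k)%nat) H 0 r /\
  forall z, f z = (taylor_poly c n z + z ^ S n * H z)%C).
{ intros (H & HH & _ & E). exists H. split; [exact HH|]. intros z _. apply E. }
induction n as [|n (H & HH & Hs & E)].
- exists (slope f). split; [now apply holomorphic_slope|].
  split; [now apply sums_to_slope|]. intros z.
  rewrite taylor_poly_0, (slope_spec f z), (sums_to_centre _ _ _ _ Hr Hc).
  simpl. ring.
- exists (slope H). split; [now apply holomorphic_slope|]. split.
  + pose proof (sums_to_slope _ _ _ Hr Hs) as Hs'.
    intros z Hz. specialize (Hs' z Hz). revert Hs'. apply is_series_ext.
    intros k. now replace (S n + S k)%nat with (S (S n) + k)%nat by lia.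
  + intros z. rewrite E, (slope_spec H z), (sums_to_centre _ _ _ _ Hr Hs),
      taylor_poly_S, Nat.add_0_r, !Cpow_S. ring.
Qed.

(** * Mean values on circles *)

(** The function [X] on the circle of radius [rho] is the boundary value of the
    real part of a holomorphic function whose real part at [0] is [v]; thus [v]
    is the mean of [X] over the circle, expressed without integration. *)
Definition circle_mean (rho : R) (X : C -> R) (v : R) : Prop :=
  exists U, holomorphic U /\ Re (U 0%C) = v /\
    forall z, Cmod z = rho -> X z = Re (U z).

Lemma circle_mean_ext (rho : R) (X Y : C -> R) (v : R) :
  (forall z, Cmod z = rho -> X z = Y z) ->
  circle_mean rho X v -> circle_mean rho Y v.
Proof.
intros E (U & HU & H0 & H). exists U. repeat split; try assumption.
intros z Hz. rewrite <- E; auto.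
Qed.

Lemma circle_mean_plus (rho : R) (X Y : C -> R) (v w : R) :
  circle_mean rho X v -> circle_mean rho Y w ->
  circle_mean rho (fun z => X z + Y z) (v + w).
Proof.
intros (U & HU & H0 & H) (V & HV & H0' & H').
exists (fun z => U z + V z)%C. split; [now apply holomorphic_plus|]. split.
- rewrite re_plus. congruence.
- intros z Hz. rewrite re_plus, H, H'; auto.
Qed.

(** A function that is nonpositive on the circle has a nonpositive mean: this is
    the maximum principle for the harmonic extension. *)
Lemma circle_mean_nonpos (rho : R) (X : C -> R) (v : R) :
  0 <= rho < 1 -> (forall z, Cmod z = rho -> X z <= 0) ->
  circle_mean rho X v -> v <= 0.
Proof.
intros Hrho HX (U & HU & <- & H).
apply (max_principle_Re U rho 0 HU Hrho).
- intros z Hz. rewrite <- H; auto.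
- rewrite Cmod_0. lra.
Qed.

Lemma pow_mult_conj (z : C) (l : nat) :
  (z ^ l * Cconj z ^ l)%C = RtoC ((Cmod z ^ 2) ^ l).
Proof.
rewrite <- Cpow_mult_l, <- Cmod2_conj. symmetry. apply RtoC_pow.
Qed.

(** On the circle [z^j conj(z)^l] equals [rho^(2j) conj(z)^(l-j)], whose real part
    is that of [z^(l-j)] up to conjugating the coefficient. *)
Lemma circle_mean_monomial_lt (rho : R) (a : C) (j l : nat) :
  (j < l)%nat ->
  circle_mean rho (fun z => Re (a * z ^ j * Cconj z ^ l)%C) 0.
Proof.
intros Hjl. destruct (Nat.le_exists_sub (S j) l Hjl) as (d & -> & _).
exists (fun z => (RtoC ((rho ^ 2) ^ j) * Cconj a) * z ^ S d)%C.
split; [|split].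
- apply (holomorphic_mult (fun _ => _)); [apply holomorphic_const|apply holomorphic_pow].
- rewrite Cpow_S, Cmult_0_l, Cmult_0_r. reflexivity.
- intros z Hz. rewrite <- re_conj, !Cmult_conj, !Cpow_conj, Cconj_conj, <- Hz,
    <- pow_mult_conj.
  replace (d + S j)%nat with (S d + j)%nat by lia. rewrite Cpow_add_r. apply (f_equal Re). ring.
Qed.

Lemma circle_mean_monomial_ge (rho : R) (a : C) (H : C -> C) (l : nat) :
  holomorphic H ->
  circle_mean rho (fun z => Re (a * (z ^ l * H z) * Cconj z ^ l)%C)
    ((rho ^ 2) ^ l * Re (a * H 0)%C).
Proof.
intros HH. exists (fun z => (RtoC ((rho ^ 2) ^ l) * a) * H z)%C. split; [|split].
- apply (holomorphic_mult (fun _ => _)); [apply holomorphic_const|exact HH].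
- rewrite <- Cmult_assoc. apply re_scal_l.
- intros z Hz. rewrite <- Hz, <- pow_mult_conj. apply (f_equal Re). ring.
Qed.

(** The Fourier coefficient of order [l] of a holomorphic function on a circle
    is its Taylor coefficient: the lower terms of the expansion contribute
    antiholomorphic monomials of mean [0], and the rest is [z^l] times a
    function taking the value [g l] at [0]. *)
Lemma circle_mean_coef (rho : R) (G : C -> C) (g : nat -> C) (a : C) (l : nat) :
  0 <= rho < 1 -> expands G g l ->
  circle_mean rho (fun z => Re (a * G z * Cconj z ^ l)%C)
    ((rho ^ 2) ^ l * Re (a * g l)%C).
Proof.
intros Hrho (H & HH & E).
set (T := fun z => (g l + z * H z)%C).
assert (HT : holomorphic T).
{ apply (holomorphic_plus (fun _ => g l)); [apply holomorphic_const|].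
  apply (holomorphic_mult (fun z => z)); [apply holomorphic_id|exact HH]. }
assert (E0 : g l = T 0%C) by (unfold T; ring).
rewrite E0. destruct l as [|l].
- apply circle_mean_ext with (fun z => Re (a * (z ^ 0 * T z) * Cconj z ^ 0)%C).
  + intros z Hz. rewrite E by (unfold in_disk; lra). rewrite taylor_poly_0.
    unfold T. apply (f_equal Re). simpl Cpow. ring.
  + now apply circle_mean_monomial_ge.
- apply circle_mean_ext with (fun z => Re (a * taylor_poly g l z * Cconj z ^ S l)%C +
     Re (a * (z ^ S l * T z) * Cconj z ^ S l)%C).
  + intros z Hz. rewrite E by (unfold in_disk; lra).
    rewrite taylor_poly_S, <- re_plus. unfold T. apply (f_equal Re). rewrite !Cpow_S. ring.
  + rewrite <- (Rplus_0_l (_ * _)).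
    apply circle_mean_plus; [|now apply circle_mean_monomial_ge].
    cut (forall i, (i <= l)%nat ->
      circle_mean rho (fun z => Re (a * taylor_poly g i z * Cconj z ^ S l)%C) 0).
    { intros Hi. now apply Hi. }
    induction i as [|i IH]; intros Hi.
    * apply circle_mean_ext with (fun z => Re ((a * g 0%nat) * z ^ 0 * Cconj z ^ S l)%C).
      -- intros z _. rewrite taylor_poly_0. apply (f_equal Re). simpl Cpow. ring.
      -- apply circle_mean_monomial_lt. lia.
    * apply circle_mean_ext with (fun z => Re (a * taylor_poly g i z * Cconj z ^ S l)%C
        + Re ((a * g (S i)) * z ^ S i * Cconj z ^ S l)%C).
      -- intros z _. rewrite taylor_poly_S, <- re_plus. apply (f_equal Re). ring.
      -- rewrite <- (Rplus_0_l 0). apply circle_mean_plus; [apply IH; lia|].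
         apply circle_mean_monomial_lt. lia.
Qed.

(** Orthogonality of the powers on a circle, for a holomorphic function against
    a polynomial. *)
Lemma circle_mean_inner (rho : R) (G : C -> C) (g p : nat -> C) (n : nat) :
  0 <= rho < 1 -> expands G g n ->
  circle_mean rho (fun z => Re (G z * Cconj (taylor_poly p n z))%C)
    (sum_n (fun l => (rho ^ 2) ^ l * Re (Cconj (p l) * g l)%C) n).
Proof.
intros Hrho. induction n as [|n IH]; intros HG.
- rewrite sum_O.
  apply circle_mean_ext with (2 := circle_mean_coef rho G g (Cconj (p 0%nat)) 0 Hrho HG).
  intros z _. rewrite taylor_poly_0. apply (f_equal Re). simpl Cpow. ring.
- rewrite sum_Sn.
  pose proof (circle_mean_plus _ _ _ _ _ (IH (expands_pred _ _ _ HG))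
    (circle_mean_coef rho G g (Cconj (p (S n))) (S n) Hrho HG)) as H.
  revert H. apply circle_mean_ext. intros z _.
  rewrite taylor_poly_S, Cplus_conj, Cmult_conj, Cpow_conj, <- re_plus.
  apply (f_equal Re). ring.
Qed.

Lemma bernoulli (e : R) (n : nat) : 0 <= e <= 1 -> 1 - INR n * e <= (1 - e) ^ n.
Proof.
intros He. induction n as [|n IH]; [simpl; lra|].
rewrite S_INR. change ((1 - e) ^ S n) with ((1 - e) * (1 - e) ^ n).
pose proof (pos_INR n). apply Rle_trans with ((1 - e) * (1 - INR n * e)).
- assert (0 <= INR n * e * e) by (repeat apply Rmult_le_pos; lra). nra.
- apply Rmult_le_compat_l; lra.
Qed.

Lemma le_1_of_pow (x : R) (n : nat) :
  (forall rho, 0 <= rho < 1 -> x * rho ^ n <= 1) -> x <= 1.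
Proof.
intros H. apply Rnot_lt_le. intros Hx.
pose proof (pos_INR n) as Hn.
set (e := (x - 1) / (x * (INR n + 1))).
assert (Hp : 0 < x * (INR n + 1)) by nra.
assert (He : e * (x * (INR n + 1)) = x - 1) by (unfold e; field; lra).
assert (He0 : 0 < e) by (apply Rdiv_lt_0_compat; lra).
assert (He1 : e <= 1) by nra.
specialize (H (1 - e) ltac:(lra)).
pose proof (bernoulli e n ltac:(lra)) as Hb.
assert (x * (1 - INR n * e) <= 1).
{ eapply Rle_trans; [|exact H]. apply Rmult_le_compat_l; lra. }
nra.
Qed.

(** Put [q = z D / F], so that [Re q <= 1/2].  For a polynomial [P] the mean of
    [Re ((q - 1/2) P conj(P))] over a circle is nonpositive.  Taking for [P] the
    Taylor polynomial of [F] of degree [m] plus a free top term [t z^(m+1)]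
    leaves the coefficients of [q P] up to degree [m + 1] equal to those of
    [z D], because [q] vanishes at [0].  The mean is then
    [sum_(k <= m) (k - 1/2) |b_k|^2 rho^(2k)
     + Re (((m+1) b_(m+1) - t/2) conj(t)) rho^(2m+2)].
    The first sum is at least [-1/2], the term [k = 0]; choosing
    [t = (m+1) b_(m+1)] makes the last term [|t|^2 rho^(2m+2) / 2], and
    [rho] tends to 1. *)
Lemma coef_bound_log_derivative (F D : C -> C) (b : nat -> C) (m : nat) :
  holomorphic F -> holomorphic D ->
  (forall z, in_disk z -> F z <> 0%C) ->
  (forall z, in_disk z -> Re (z * D z / F z)%C <= 1 / 2) ->
  b 0%nat = 1%C -> expands F b m ->
  expands (fun z => z * D z)%C (fun k => INR k * b k)%C (S m) ->
  INR (S m) * Cmod (b (S m)) <= 1.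
Proof.
intros HF HD Hnz Hre Hb0 (HFr & HHF & EF) (HDr & HHD & ED).
set (top := (INR (S m) * b (S m))%C).
set (p := fun k => if Nat.eqb k (S m) then top else b k).
set (P := taylor_poly p (S m)).
set (g := fun k => (INR k * b k - / 2 * p k)%C).
set (G := fun z => ((z * D z / F z - / 2) * P z)%C).
assert (Hp_top : p (S m) = top) by (unfold p; now rewrite Nat.eqb_refl).
assert (Hp_low : forall k, (k <= m)%nat -> p k = b k).
{ intros k Hk. unfold p. destruct (Nat.eqb_spec k (S m)); [lia|reflexivity]. }
assert (HP : forall z, P z = (taylor_poly b m z + top * z ^ S m)%C).
{ intros z. unfold P. rewrite taylor_poly_S, Hp_top. f_equal.
  unfold taylor_poly. apply sum_n_ext_loc. intros k Hk. now rewrite Hp_low. }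
assert (Hg : forall n z, taylor_poly g n z =
   (taylor_poly (fun k => INR k * b k)%C n z - / 2 * taylor_poly p n z)%C).
{ intros n z. induction n as [|n IH].
  - rewrite !taylor_poly_0. reflexivity.
  - rewrite !taylor_poly_S, IH. unfold g. ring. }
assert (HG : expands G g (S m)).
{ exists (fun z => HDr z + (D z * / F z) * (top + (- 1) * HFr z))%C. split.
  - apply (holomorphic_plus HDr); [exact HHD|].
    apply (holomorphic_mult (fun z => D z * / F z)%C).
    + apply holomorphic_mult; [exact HD|]. now apply holomorphic_inv.
    + apply (holomorphic_plus (fun _ => top)); [apply holomorphic_const|].
      apply (holomorphic_mult (fun _ => (- 1)%C)); [apply holomorphic_const|exact HHF].
  - intros z Hz. rewrite Hg. fold (P z). unfold G.
    assert (E1 : taylor_poly (fun k => INR k * b k)%C (S m) z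
                 = (z * D z - z ^ S (S m) * HDr z)%C) by (rewrite (ED z Hz); ring).
    assert (E2 : P z = (F z + z ^ S m * (top + (- 1) * HFr z))%C).
    { rewrite HP, (EF z Hz). ring. }
    rewrite E1.
    transitivity (z * D z / F z * P z - / 2 * P z)%C; [ring|].
    rewrite E2 at 1. rewrite (Cpow_S z (S m)). field. now apply Hnz. }
assert (Hkey : forall rho, 0 <= rho < 1 ->
  Cmod top ^ 2 * (rho ^ 2) ^ S m <= 1).
{ intros rho Hrho.
  assert (Hv : sum_n (fun l => (rho ^ 2) ^ l * Re (Cconj (p l) * g l)%C) (S m) <= 0).
  { refine (circle_mean_nonpos rho _ _ Hrho _ (circle_mean_inner rho G g p (S m) Hrho HG)).
    intros z Hz. cbv beta. fold (P z). unfold G.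
    rewrite <- Cmult_assoc, <- Cmod2_conj, re_scal_r.
    assert (Hz1 : in_disk z) by (unfold in_disk; lra).
    specialize (Hre z Hz1). unfold Cminus. rewrite re_plus, re_opp.
    rewrite <- RtoC_inv, re_RtoC by lra.
    pose proof (pow2_ge_0 (Cmod (P z))). nra. }
  rewrite sum_Sn in Hv.
  assert (Hr2 : forall l, 0 <= (rho ^ 2) ^ l) by (intros l; apply pow_le, pow2_ge_0).
  assert (Hlow : forall n, (n <= m)%nat ->
    - (1 / 2) <= sum_n (fun l => (rho ^ 2) ^ l * Re (Cconj (p l) * g l)%C) n).
  { assert (Hterm : forall l, (l <= m)%nat ->
      Re (Cconj (p l) * g l)%C = (INR l - / 2) * Cmod (b l) ^ 2).
    { intros l Hl. unfold g. rewrite Hp_low by exact Hl.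
      replace (Cconj (b l) * (INR l * b l - / 2 * b l))%C
        with (RtoC (INR l - / 2) * (b l * Cconj (b l)))%C.
      - rewrite re_scal_l, Cmod2_Re. reflexivity.
      - rewrite RtoC_minus, RtoC_inv by lra. ring. }
    induction n as [|n IH]; intros Hn.
    - rewrite sum_O, Hterm, Hb0, Cmod_1 by lia. simpl. lra.
    - rewrite sum_Sn, Hterm by exact Hn. specialize (IH ltac:(lia)).
      set (s := sum_n _ n) in *.
      change (- (1 / 2) <= s + (rho ^ 2) ^ S n * ((INR (S n) - / 2) * Cmod (b (S n)) ^ 2)).
      assert (0 <= (rho ^ 2) ^ S n * ((INR (S n) - / 2) * Cmod (b (S n)) ^ 2)); [|lra].
      apply Rmult_le_pos; [apply Hr2|]. apply Rmult_le_pos; [|apply pow2_ge_0].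
      rewrite S_INR. pose proof (pos_INR n). lra. }
  specialize (Hlow m ltac:(lia)). set (s := sum_n _ m) in *.
  change (s + (rho ^ 2) ^ S m * Re (Cconj (p (S m)) * g (S m))%C <= 0) in Hv.
  unfold g in Hv. rewrite Hp_top in Hv. fold top in Hv.
  replace (Cconj top * (top - / 2 * top))%C
    with (RtoC (/ 2) * (top * Cconj top))%C in Hv by (rewrite RtoC_inv by lra; field).
  rewrite re_scal_l, Cmod2_Re in Hv. lra. }
assert (Htop : Cmod top ^ 2 <= 1).
{ apply le_1_of_pow with (n := (2 * S m)%nat). intros rho Hrho.
  rewrite pow_mult. now apply Hkey. }
replace (INR (S m) * Cmod (b (S m))) with (Cmod top).
- pose proof (Cmod_ge_0 top). nra.
- unfold top. rewrite Cmod_mult, Cmod_R, Rabs_pos_eq by apply pos_INR. reflexivity.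
Qed.

(** * The coefficients of functions in the class *)

Lemma sums_to_derive_n (f : C -> C) (c : nat -> C) (r : R) (k : nat) :
  sums_to c f 0 r -> sums_to (Nat.iter k C_PS_derive c) (C_derive_n f k) 0 r.
Proof.
intros H. induction k as [|k IH]; [exact H|]. apply (sums_to_derive _ _ _ _ IH).
Qed.

Lemma iter_PS_derive (c : nat -> C) (k j : nat) :
  (INR (fact j) * Nat.iter k C_PS_derive c j = INR (fact (j + k)) * c (j + k)%nat)%C.
Proof.
revert j; induction k as [|k IH]; intros j.
- now rewrite Nat.add_0_r.
- change (Nat.iter (S k) C_PS_derive c j)
    with (INR (S j) * Nat.iter k C_PS_derive c (S j))%C.
  rewrite <- Nat.add_succ_comm, <- IH, fact_simpl, mult_INR, RtoC_mult. ring.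
Qed.

Lemma taylor_coef_power_series (f : C -> C) (c : nat -> C) (r : R) (k : nat) :
  0 < r -> sums_to c f 0 r -> taylor_coef f k = c k.
Proof.
intros Hr H. unfold taylor_coef.
rewrite (sums_to_centre _ _ _ _ Hr (sums_to_derive_n f c r k H)).
pose proof (iter_PS_derive c k 0) as E. simpl (0 + k)%nat in E.
change (INR (fact 0)) with 1 in E. rewrite Cmult_1_l in E. rewrite E.
field. intros H0. apply RtoC_inj in H0. exact (INR_fact_neq_0 k H0).
Qed.

Lemma taylor_poly_PS_derive (c : nat -> C) (n : nat) (z : C) :
  (z * taylor_poly (C_PS_derive c) n z)%C = taylor_poly (fun k => INR k * c k)%C (S n) z.
Proof.
induction n as [|n IH].
- rewrite taylor_poly_S, !taylor_poly_0. unfold C_PS_derive. simpl. ring.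
- rewrite taylor_poly_S, (taylor_poly_S _ (S n)), <- IH. unfold C_PS_derive.
  rewrite (Cpow_S z (S n)). ring.
Qed.

(** The condition defining the class says that [z f'' / f'] has real part less
    than [1/2], so the bound for [F = f'] applies; [b_k = (k+1) c_(k+1)] turns it
    into the one stated. *)
Lemma class_G_coef_bound (f : C -> C) (c : nat -> C) (r : R) (m : nat) :
  class_G f -> 0 < r -> sums_to c f 0 r ->
  Cmod (c (S (S m))) <= 1 / (INR (S m) * INR (S (S m))).
Proof.
intros ((Hana & Hf0 & Hf1) & _ & Hnz & Hre) Hr Hc.
apply analytic_has_power_series in Hana.
pose proof (has_power_series_derive _ Hana) as HF.
pose proof (has_power_series_derive _ HF) as HD.
apply has_power_series_holomorphic in HF, HD.
set (F := C_derive f) in *. set (D := C_derive F) in *.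
set (b := C_PS_derive c).
pose proof (sums_to_derive _ _ _ _ Hc) as Hb. fold F b in Hb.
pose proof (sums_to_derive _ _ _ _ Hb) as Hd. fold D in Hd.
assert (H : INR (S m) * Cmod (b (S m)) <= 1).
{ apply (coef_bound_log_derivative F D b m HF HD Hnz).
  - intros z Hz. specialize (Hre z Hz).
    change (C_derive_n f 2 z) with (D z) in Hre.
    rewrite re_plus, re_RtoC in Hre. lra.
  - rewrite <- (sums_to_centre _ _ _ _ Hr Hb). exact Hf1.
  - exact (expands_of_sums_to _ _ _ _ HF Hr Hb).
  - destruct (expands_of_sums_to _ _ _ m HD Hr Hd) as (H & HH & E).
    exists H. split; [exact HH|]. intros z Hz.
    rewrite (E z Hz), <- taylor_poly_PS_derive, (Cpow_S z (S m)). ring. }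
unfold b, C_PS_derive in H.
rewrite Cmod_mult, Cmod_R, Rabs_pos_eq in H by apply pos_INR.
assert (H1 : 0 < INR (S m)) by (apply lt_0_INR; lia).
assert (H2 : 0 < INR (S (S m))) by (apply lt_0_INR; lia).
apply (Rmult_le_reg_l (INR (S m) * INR (S (S m)))); [now apply Rmult_lt_0_compat|].
replace (_ * _ * (1 / _)) with 1 by (field; lra). lra.
Qed.

(** * Remainders of the Taylor series *)

(** Beyond the first term the powers of [Cmod z] are replaced by the lowest one,
    and the sum of [1/(k(k-1))] telescopes. *)
Lemma taylor_poly_tail (c : nat -> C) (n j : nat) (z : C) :
  (1 <= n)%nat -> Cmod z <= 1 ->
  (forall m, Cmod (c (S (S m))) <= 1 / (INR (S m) * INR (S (S m)))) ->
  Cmod (taylor_poly c (S n + j) z - taylor_poly c n z)%C <=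
    Cmod z ^ S n / (INR n * (INR n + 1))
    + Cmod z ^ S (S n) * (1 / (INR n + 1) - 1 / (INR n + 1 + INR j)).
Proof.
intros Hn Hz Hc. set (r := Cmod z) in *.
assert (Hr : 0 <= r) by apply Cmod_ge_0.
assert (Hn1 : 1 <= INR n) by (apply (le_INR 1), Hn).
induction j as [|j IH].
- rewrite Nat.add_0_r, taylor_poly_S.
  replace (_ + _ - _)%C with (c (S n) * z ^ S n)%C by ring.
  rewrite Cmod_mult, Cmod_pow. fold r.
  destruct n as [|m]; [lia|]. specialize (Hc m). rewrite (S_INR (S m)) in Hc.
  simpl (INR 0). rewrite Rplus_0_r, Rminus_diag, Rmult_0_r, Rplus_0_r.
  apply (Rmult_le_compat_r (r ^ S (S m))) in Hc; [|now apply pow_le].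
  eapply Rle_trans; [exact Hc|]. apply Req_le. field. lra.
- rewrite Nat.add_succ_r, taylor_poly_S.
  replace (_ + _ - _)%C with ((taylor_poly c (S n + j) z - taylor_poly c n z)
    + c (S (S n + j)) * z ^ S (S n + j))%C by ring.
  eapply Rle_trans; [apply Cmod_triangle|].
  eapply Rle_trans; [apply Rplus_le_compat_r, IH|]. clear IH.
  rewrite Cmod_mult, Cmod_pow. fold r.
  specialize (Hc (n + j)%nat). change (S (S (n + j))) with (S (S n + j)) in Hc.
  pose proof (pos_INR j) as Hj.
  assert (EI : INR (S (n + j)) = INR n + 1 + INR j) by (rewrite S_INR, plus_INR; ring).
  change (S n + j)%nat with (S (n + j)) in *.
  rewrite (S_INR (S (n + j))), EI in Hc. rewrite (S_INR j).
  assert (Hpow : r ^ S (S (n + j)) <= r ^ S (S n)).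
  { replace (S (S (n + j))) with (S (S n) + j)%nat by lia. rewrite pow_add.
    rewrite <- (Rmult_1_r (r ^ S (S n))) at 2.
    apply Rmult_le_compat_l; [now apply pow_le|].
    rewrite <- (pow1 j). apply pow_incr. lra. }
  assert (Ht : Cmod (c (S (S (n + j)))) * r ^ S (S (n + j)) <=
    1 / ((INR n + 1 + INR j) * (INR n + 1 + INR j + 1)) * r ^ S (S n)).
  { apply Rmult_le_compat; [apply Cmod_ge_0|now apply pow_le|exact Hc|exact Hpow]. }
  eapply Rle_trans; [apply Rplus_le_compat_l, Ht|]. apply Req_le. field. lra.
Qed.

Lemma taylor_poly_tail_le (c : nat -> C) (n j : nat) (z : C) :
  (1 <= n)%nat -> Cmod z <= 1 ->
  (forall m, Cmod (c (S (S m))) <= 1 / (INR (S m) * INR (S (S m)))) ->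
  Cmod (taylor_poly c (S n + j) z - taylor_poly c n z)%C <=
    Cmod z ^ S n * (1 / (INR n * (INR n + 1)) + Cmod z / (INR n + 1)).
Proof.
intros Hn Hz Hc. eapply Rle_trans; [now apply taylor_poly_tail|].
pose proof (pos_INR n) as Hn0. pose proof (pos_INR j) as Hj.
assert (Hn1 : 1 <= INR n) by (apply (le_INR 1), Hn).
assert (0 <= Cmod z ^ S (S n) * (1 / (INR n + 1 + INR j))).
{ apply Rmult_le_pos; [apply pow_le, Cmod_ge_0|].
  apply Rlt_le, Rdiv_lt_0_compat; lra. }
rewrite Rmult_minus_distr_l.
replace (Cmod z ^ S n * (1 / (INR n * (INR n + 1)) + Cmod z / (INR n + 1)))
  with (Cmod z ^ S n / (INR n * (INR n + 1))
  + Cmod z ^ S (S n) * (1 / (INR n + 1))) by (simpl; field; lra).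
lra.
Qed.

Lemma holomorphic_bounded (f : C -> C) (rho : R) :
  holomorphic f -> 0 <= rho < 1 ->
  exists M, forall z, Cmod z <= rho -> Cmod (f z) <= M.
Proof.
intros Hf Hrho.
destruct (closed_disk_max (fun z => Cmod (f z)) rho) as (z0 & _ & H); [lra| |].
- intros z Hz.
  destruct (holomorphic_lipschitz_at f z Hf ltac:(unfold in_disk; lra))
    as (K & r & HK & Hr & H).
  exists K, r. split; [exact HK|]. split; [exact Hr|]. intros h Hh.
  specialize (H h Hh). pose proof (Cmod_triangle (f z) (f (z + h) - f z)%C) as H1.
  rewrite Cplus_sub_cancel in H1. lra.
- exists (Cmod (f z0)). exact H.
Qed.

(** The local Taylor series at [0] represents [f] on the whole disk: writing
    [f - taylor_poly c N = z^(N+1) H] and bounding [H] by its maximum on a circle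
    of radius [rho > Cmod z], where [f] and the Taylor polynomials are bounded
    uniformly in [N], the remainder is [O((Cmod z / rho)^(N+1))].  The bound on
    finite tails therefore passes to the limit. *)
Lemma taylor_remainder_bound (f : C -> C) (c : nat -> C) (n : nat) (z : C) :
  holomorphic f -> (forall N, expands f c N) -> c 0%nat = 0%C -> c 1%nat = 1%C ->
  (forall m, Cmod (c (S (S m))) <= 1 / (INR (S m) * INR (S (S m)))) ->
  (1 <= n)%nat -> in_disk z ->
  Cmod (f z - taylor_poly c n z)%C <=
    Cmod z ^ S n * (1 / (INR n * (INR n + 1)) + Cmod z / (INR n + 1)).
Proof.
intros Hf Hexp Hc0 Hc1 Hc Hn Hz. unfold in_disk in Hz.
pose proof (Cmod_ge_0 z) as Hz0.
set (rho := (Cmod z + 1) / 2).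
assert (Hrho : 0 < rho < 1) by (unfold rho; lra).
assert (Hzr : Cmod z < rho) by (unfold rho; lra).
destruct (holomorphic_bounded f rho Hf ltac:(lra)) as (M & HM).
set (x := Cmod z / rho).
assert (Hx : 0 <= x < 1).
{ unfold x. split; [apply Rdiv_le_0_compat; lra|].
  apply (Rmult_lt_reg_r rho); [lra|]. unfold Rdiv.
  rewrite Rmult_assoc, Rinv_l; lra. }
assert (Hpoly : forall j w, Cmod w <= 1 -> Cmod (taylor_poly c (2 + j) w) <= 2).
{ intros j w Hw. pose proof (taylor_poly_tail_le c 1 j w (Nat.le_refl 1) Hw Hc) as H.
  rewrite taylor_poly_S, taylor_poly_0, Hc0, Hc1 in H.
  pose proof (Cmod_ge_0 w) as Hw0.
  replace (taylor_poly c (2 + j) w)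
    with ((taylor_poly c (2 + j) w - (0 + 1 * w ^ 1)) + w)%C by (simpl Cpow; ring).
  eapply Rle_trans; [apply Cmod_triangle|].
  change (2 + j)%nat with (S 1 + j)%nat.
  assert (Cmod w ^ 2 * (1 / (INR 1 * (INR 1 + 1)) + Cmod w / (INR 1 + 1)) <= 1).
  { change (INR 1) with 1. assert (0 <= Cmod w ^ 2 <= 1) by nra. nra. }
  lra. }
assert (Hrem : forall j, Cmod (f z - taylor_poly c (2 + j) z)%C
                 <= (M + 2) * x ^ (3 + j)).
{ intros j. destruct (Hexp (2 + j)%nat) as (H & HH & E).
  change (S (2 + j)) with (3 + j)%nat in E. set (N := (3 + j)%nat) in *.
  assert (HHb : Cmod (H z) <= (M + 2) / rho ^ N).
  { apply (max_principle_Cmod H rho); [exact HH|lra| |lra].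
    intros w Hw. apply (Rmult_le_reg_r (rho ^ N)); [apply pow_lt; lra|].
    unfold Rdiv. rewrite Rmult_assoc, Rinv_l, Rmult_1_r by (apply pow_nonzero; lra).
    rewrite <- Hw, <- Cmod_pow, <- Cmod_mult.
    replace (H w * w ^ N)%C with (f w + - taylor_poly c (2 + j) w)%C.
    - eapply Rle_trans; [apply Cmod_triangle|]. rewrite Cmod_opp.
      apply Rplus_le_compat; [apply HM; lra|apply Hpoly; lra].
    - rewrite (E w) by (unfold in_disk; lra). ring. }
  rewrite (E z Hz). replace (_ + _ - _)%C with (z ^ N * H z)%C by ring.
  rewrite Cmod_mult, Cmod_pow. unfold x, Rdiv. rewrite Rpow_mult_distr, pow_inv.
  apply (Rmult_le_compat_l (Cmod z ^ N)) in HHb; [|now apply pow_le].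
  unfold Rdiv in HHb. lra. }
apply le_epsilon. intros eps Heps.
assert (HM0 : 0 <= M) by (eapply Rle_trans; [apply Cmod_ge_0|apply (HM z); lra]).
destruct (pow_lt_1_zero x) with (y := eps / (M + 2)) as (N & HN).
{ rewrite Rabs_pos_eq; lra. }
{ apply Rdiv_lt_0_compat; lra. }
set (j := (n + N)%nat).
specialize (HN (3 + j)%nat ltac:(unfold j; lia)).
rewrite Rabs_pos_eq in HN by (apply pow_le; lra).
specialize (Hrem j).
pose proof (taylor_poly_tail_le c n (1 + N) z Hn ltac:(lra) Hc) as Ht.
replace (S n + (1 + N))%nat with (2 + j)%nat in Ht by (unfold j; lia).
replace (f z - taylor_poly c n z)%C with ((taylor_poly c (2 + j) z - taylor_poly c n z)
  + (f z - taylor_poly c (2 + j) z))%C by ring.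
eapply Rle_trans; [apply Cmod_triangle|]. apply Rplus_le_compat; [exact Ht|].
eapply Rle_trans; [exact Hrem|].
apply (Rmult_lt_compat_l (M + 2)) in HN; [|lra].
replace ((M + 2) * (eps / (M + 2))) with eps in HN by (field; lra). lra.
Qed.

Lemma partial_sum_taylor_poly (f : C -> C) (c : nat -> C) (n : nat) (z : C) :
  (forall k, taylor_coef f k = c k) -> c 0%nat = 0%C -> c 1%nat = 1%C ->
  (1 <= n)%nat -> partial_sum f n z = taylor_poly c n z.
Proof.
intros Hc Hc0 Hc1 Hn. unfold partial_sum.
induction Hn as [|n Hn IH].
- rewrite sum_n_m_zero by lia. rewrite taylor_poly_S, taylor_poly_0, Hc0, Hc1.
  change (z + 0 = 0 + 1 * z ^ 1)%C. simpl Cpow. ring.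
- rewrite sum_n_Sm by lia. rewrite taylor_poly_S, <- IH, <- Hc.
  set (s := sum_n_m _ 2 n).
  change (z + (s + taylor_coef f (S n) * z ^ S n) =
    z + s + taylor_coef f (S n) * z ^ S n)%C. ring.
Qed.

(** * The estimate for the sections *)

(** With [1/(1-r) = 1 + r/(1-r)] the left side is [1/(n(n+1)) + r/(n(1-r))], and
    [1/n <= 1 <= 2/s]. *)
Lemma quotient_bound_arith (n r s : R) :
  1 <= n -> 0 <= r < 1 -> 0 < s <= 2 ->
  (1 / (n * (n + 1)) + r / (n + 1)) / (1 - r)
    <= 1 / (n * (n + 1)) + 2 * r / (s * (1 - r)).
Proof.
intros Hn Hr Hs.
replace ((1 / (n * (n + 1)) + r / (n + 1)) / (1 - r))
  with (1 / (n * (n + 1)) + r / (1 - r) * / n) by (field; lra).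
replace (2 * r / (s * (1 - r))) with (r / (1 - r) * (2 / s)) by (field; lra).
apply Rplus_le_compat_l, Rmult_le_compat_l; [apply Rdiv_le_0_compat; lra|].
apply Rle_trans with 1.
- rewrite <- Rinv_1. apply Rinv_le_contravar; lra.
- apply (Rmult_le_reg_r s); [lra|]. unfold Rdiv. rewrite Rmult_assoc, Rinv_l; lra.
Qed.

Theorem theorem3p4 (f : C -> C) (hf : class_G f) (n : nat) (hn : (2 <= n)%nat)
    (z : C) (hz : Cmod z < 1) :
  Cmod (section_quotient f n z - 1)%C <=
    Cmod z ^ n *
      (1 / (INR n * (INR n + 1)) + 2 * Cmod z / (sqrt 3 * (1 - Cmod z))).
Proof.
pose proof (Cmod_ge_0 z) as Hr0.
assert (Hn1 : 1 <= INR n) by (apply (le_INR 1); lia).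
assert (Hsqrt : 0 < sqrt 3 <= 2).
{ split; [apply sqrt_lt_R0; lra|]. rewrite <- (sqrt_square 2) by lra.
  apply sqrt_le_1; lra. }
pose proof (quotient_bound_arith (INR n) (Cmod z) (sqrt 3) Hn1 ltac:(lra) Hsqrt) as Harith.
unfold section_quotient. destruct (Ceq_dec z 0) as [Ez|Hz0].
{ replace (1 - 1)%C with (RtoC 0) by ring. rewrite Cmod_0.
  apply Rmult_le_pos; [apply pow_le; lra|].
  eapply Rle_trans; [|exact Harith].
  apply Rdiv_le_0_compat; [|lra]. apply Rplus_le_le_0_compat.
  - apply Rdiv_le_0_compat; nra.
  - apply Rdiv_le_0_compat; lra. }
pose proof hf as ((Hana & Hf0 & Hf1) & _).
apply analytic_has_power_series in Hana.
pose proof (has_power_series_holomorphic _ Hana) as Hf.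
destruct (Hana 0%C) as (c & r & Hr & Hc); [unfold in_disk; rewrite Cmod_0; lra|].
pose proof (fun m => class_G_coef_bound f c r m hf Hr Hc) as Hcoef.
pose proof (fun k => taylor_coef_power_series f c r k Hr Hc) as Htc.
assert (Hc0 : c 0%nat = 0%C) by (rewrite <- (sums_to_centre _ _ _ _ Hr Hc); exact Hf0).
assert (Hc1 : c 1%nat = 1%C).
{ pose proof (sums_to_centre _ _ _ _ Hr (sums_to_derive _ _ _ _ Hc)) as E.
  rewrite Hf1 in E. unfold C_PS_derive in E. rewrite Cmult_1_l in E. now symmetry. }
pose proof (fun k Hk => taylor_remainder_bound f c k z Hf
  (fun N => expands_of_sums_to f c r N Hf Hr Hc) Hc0 Hc1 Hcoef Hk hz) as Hrem.
rewrite (partial_sum_taylor_poly f c n z Htc Hc0 Hc1) by lia.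
assert (Hr1 : 0 < Cmod z) by now apply Cmod_gt_0.
assert (Hlow : Cmod z * (1 - Cmod z) <= Cmod (f z)).
{ specialize (Hrem 1%nat (Nat.le_refl 1)).
  rewrite taylor_poly_S, taylor_poly_0, Hc0, Hc1 in Hrem.
  replace (0 + 1 * z ^ 1)%C with z in Hrem by (simpl Cpow; ring).
  pose proof (Cmod_triangle_inv z (f z - z)%C) as H1. rewrite Cplus_sub_cancel in H1.
  change (INR 1) with 1 in Hrem.
  assert (Cmod z ^ 2 * (1 / (1 * (1 + 1)) + Cmod z / (1 + 1)) <= Cmod z ^ 2).
  { assert (0 <= Cmod z ^ 2) by (apply pow2_ge_0). nra. }
  nra. }
assert (Hlow0 : 0 < Cmod z * (1 - Cmod z)) by (apply Rmult_lt_0_compat; lra).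
assert (Hfz : f z <> 0%C) by (apply Cmod_gt_0; lra).
replace (taylor_poly c n z / f z - 1)%C
  with (- (f z - taylor_poly c n z) / f z)%C by (field; exact Hfz).
rewrite Cmod_div, Cmod_opp by exact Hfz.
specialize (Hrem n ltac:(lia)).
apply Rle_trans with (Cmod z ^ S n * (1 / (INR n * (INR n + 1)) + Cmod z / (INR n + 1))
  / (Cmod z * (1 - Cmod z))).
- apply Rmult_le_compat; [apply Cmod_ge_0| |exact Hrem|].
  + apply Rlt_le, Rinv_0_lt_compat. lra.
  + apply Rinv_le_contravar; assumption.
- replace (_ / (Cmod z * (1 - Cmod z))) with
    (Cmod z ^ n * ((1 / (INR n * (INR n + 1)) + Cmod z / (INR n + 1)) / (1 - Cmod z)))
    by (simpl; field; lra).
  apply Rmult_le_compat_l; [apply pow_le; lra|exact Harith].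
Qed.
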